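(* Let $k\ge2$ be an integer, let $P\in\mathscr{A}$ be a self-adjoint projection with $\tau(P)=1/k$ which is free from $\{U_t,U_t^{\star}\}_{t\ge0}$, let $J_t = PU_tPU_t^{\star}P$ and $T_k = kP-{\bf 1}$. Then for any $n\ge1$ and $t>0$, $$m_n(t) := k\,\tau(J_t^n) = m_n(\infty) + \frac{k}{k^{2n}}\sum_{j=1}^n (k-1)^{n-j}\binom{2n}{n-j}\,\tau[(T_kU_tT_kU_t^{\star})^j],$$ where $m_n(\infty)$ is the $n$-th moment of $J_{\infty} = PU_{\infty}PU_{\infty}^{\star}P$ in $(P\mathscr{A}P,k\tau)$, given by $$m_n(\infty) = 1-\sum_{j=0}^{n-1}\frac{(k-1)^{j+1}}{k^{2j+1}}C_j = \frac{2(k-1)^{n+1}}{k^{2n+1}}\left\{\binom{2n}{n} - \frac{(k-2)}{2\,n!\,(k-1)^{n+1}}k^n\mathscr{P}_n\left(\frac{k-2}{k}\right)\right\}.$$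
   Context: $(\mathscr{A},\tau)$ is a tracial non commutative probability space (a von Neumann algebra with faithful normal tracial state $\tau$). $(U_t)_{t\ge 0}$ is a free unitary Brownian motion in $\mathscr{A}$, i.e. the solution of the free stochastic differential equation $dU_t = iU_t\,dX_t - \frac{1}{2}U_t\,dt$, $U_0 = {\bf 1}$, where $(X_t)_{t \ge 0}$ is a free additive Brownian motion. $U_{\infty}\in\mathscr{A}$ is a Haar unitary operator free from $P$. $C_j = \frac{1}{j+1}\binom{2j}{j}$ is the $j$-th Catalan number. $\mathscr{P}_n$ is the polynomial of degree $n$ determined by $\frac{d^n}{dz^n}\left[\frac{z^n}{1+\sqrt{z}}\right] = \frac{\mathscr{P}_n(\sqrt{z})}{2^n(1+\sqrt{z})^{n+1}}$ for $z>0$. *)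

(* Defs.v *)
From HB Require Import structures.
From mathcomp Require Import all_boot all_order all_algebra.
From mathcomp Require Import all_classical all_reals all_analysis.
From mathcomp Require Import complex.

Set Implicit Arguments.
Unset Strict Implicit.
Unset Printing Implicit Defensive.

Import Order.TTheory GRing.Theory Num.Theory.
Import numFieldNormedType.Exports.

Local Open Scope classical_set_scope.
Local Open Scope ring_scope.
Local Open Scope complex_scope.

Section VonNeumannAlgebra.
Variable R : realType.

(* [A] is identified with the von Neumann algebra [pi(A)] acting on the Hilbert
   space [H].  [rep_adjoint] and [rep_inj] force [star] to be the involution
   transported from bounded operators, so no *-algebra axioms are listed. *)
Record vN_representation (A : algType R[i]) (star : A -> A)
    (H : completeNormedModType R[i]) (dot : {dot H for Num.conj})
    (pi : A -> {linear H -> H}) : Prop := {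
  rep_norm : forall x, `|x| ^+ 2 = dot x x ;
  rep_bounded : forall a, continuous (pi a) ;
  rep_inj : forall a b, pi a =1 pi b -> a = b ;
  rep_linear : forall c a b x, pi (c *: a + b) x = c *: pi a x + pi b x ;
  rep_one : forall x, pi 1 x = x ;
  rep_mul : forall a b x, pi (a * b) x = pi a (pi b x) ;
  rep_adjoint : forall a x y, dot (pi a x) y = dot x (pi (star a) y) ;
  rep_bicommutant : forall T : {linear H -> H}, continuous T ->
    (forall S : {linear H -> H}, continuous S ->
       (forall a, S \o pi a =1 pi a \o S) -> T \o S =1 S \o T) ->
    exists a, T =1 pi a }.

Section Trace.
Variables (A : algType R[i]) (star : A -> A).

Definition op_le (a b : A) := exists c, b - a = star c * c.

Definition op_lub (D : set A) (s : A) :=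
  [/\ star s = s, forall d, D d -> op_le d s
    & forall b, star b = b -> (forall d, D d -> op_le d b) -> op_le s b].

(* [R[i]] is ordered by [x <= y] iff [y - x] is a nonnegative real. *)
Record faithful_normal_tracial_state (tau : {scalar A}) : Prop := {
  trace_one : tau 1 = 1 ;
  trace_ge0 : forall a, 0 <= tau (star a * a) ;
  trace_comm : forall a b, tau (a * b) = tau (b * a) ;
  trace_faithful : forall a, tau (star a * a) = 0 -> a = 0 ;
  trace_normal : forall (D : set A) (s : A),
    D !=set0 -> (forall d, D d -> star d = d) ->
    (forall d e, D d -> D e -> exists f, [/\ D f, op_le d f & op_le e f]) ->
    op_lub D s -> supremums [set tau d | d in D] (tau s) }.

End Trace.

Record tracial_vN_algebra := {
  vN_carrier :> algType R[i] ;
  star : vN_carrier -> vN_carrier ;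
  vN_space : completeNormedModType R[i] ;
  vN_dot : {dot vN_space for Num.conj} ;
  vN_pi : vN_carrier -> {linear vN_space -> vN_space} ;
  tau : {scalar vN_carrier} ;
  vN_repP : vN_representation star vN_dot vN_pi ;
  tauP : faithful_normal_tracial_state star tau }.

End VonNeumannAlgebra.

Arguments star {R t}.
Arguments tau {R t}.
Arguments vN_pi {R t}.

Section FreeProbability.
Variables (R : realType) (A : tracial_vN_algebra R).

Definition self_adjoint (a : A) := star a = a.
Definition sa_projection (a : A) := self_adjoint a /\ a * a = a.
Definition unitary_elt (u : A) := star u * u = 1 /\ u * star u = 1.

Definition L2norm (a : A) : R := Num.sqrt (complex.Re (tau (star a * a))).

Definition unital_star_subalgebra (B : set A) :=
  [/\ B 1, forall (c : R[i]) a b, B a -> B b -> B (c *: a + b),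
      forall a b, B a -> B b -> B (a * b) & forall a, B a -> B (star a)].

Definition star_algebra_gen (S : set A) : set A :=
  smallest unital_star_subalgebra S.

(* The von Neumann subalgebra generated by [S]: the bicommutant of the
   self-adjoint set [S `|` star @` S]. *)
Definition vN_algebra_gen (S : set A) : set A :=
  [set a | forall T : {linear vN_space A -> vN_space A}, continuous T ->
     (forall s, S s ->
        T \o vN_pi s =1 vN_pi s \o T /\
        T \o vN_pi (star s) =1 vN_pi (star s) \o T) ->
     T \o vN_pi a =1 vN_pi a \o T].

Definition free_subalgebras (I : eqType) (B : I -> set A) :=
  forall w : seq (I * A), w != [::] ->
    (forall x, x \in w -> B x.1 x.2 /\ tau x.2 = 0) ->
    sorted (fun x y => x.1 != y.1) w ->
    tau (\prod_(x <- w) x.2) = 0.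

Definition free_sets (S1 S2 : set A) :=
  free_subalgebras (fun b : bool => star_algebra_gen (if b then S1 else S2)).

Definition haar_unitary (u : A) :=
  unitary_elt u /\
  forall m : nat, (0 < m)%N -> tau (u ^+ m) = 0 /\ tau (star u ^+ m) = 0.

(* The distribution of [a] is the centred semicircle law of variance [v]. *)
Definition semicircular (v : R) (a : A) :=
  self_adjoint a /\
  forall m : nat, tau (a ^+ m) =
    (\int[lebesgue_measure]_(x in `[- (2 * Num.sqrt v), 2 * Num.sqrt v])
       (x ^+ m * (Num.sqrt (4 * v - x ^+ 2) / (2 * pi * v))))%:C.

(* Processes are indexed by [R], only their values at times [>= 0] matter. *)
Record free_additive_brownian_motion (X : R -> A) : Prop := {
  fbm0 : X 0 = 0 ;
  fbm_sa : forall t, 0 <= t -> self_adjoint (X t) ;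
  fbm_semicircular : forall s t, 0 <= s -> s < t ->
    semicircular (t - s) (X t - X s) ;
  fbm_free : forall s t, 0 <= s -> s < t ->
    free_sets [set X t - X s] [set X r | r in `[0, s]] }.

Definition adapted (X Y : R -> A) :=
  forall t, 0 <= t -> vN_algebra_gen [set X r | r in `[0, t]] (Y t).

Definition L2_continuous (Y : R -> A) :=
  forall t, 0 <= t -> forall e, 0 < e -> exists2 d, 0 < d &
    forall s, 0 <= s -> `|s - t| < d -> L2norm (Y s - Y t) < e.

(* [I] is the integral over [0, t] of [Y] against [dZ], as the L2-limit, when
   the mesh goes to 0, of the left-endpoint sums of
   [Y_{t_j} (Z_{t_{j+1}} - Z_{t_j})].  For [Y] adapted and L2-continuous and
   [Z] a free Brownian motion, this is the free Ito integral. *)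
Definition is_integral (Y Z : R -> A) (t : R) (I : A) :=
  forall e, 0 < e -> exists2 d, 0 < d &
    forall s : seq R, itv_partition 0 t s ->
      let p := nth t (0 :: s) in
      (forall j, (j < size s)%N -> p j.+1 - p j < d) ->
      L2norm (\sum_(0 <= j < size s) Y (p j) * (Z (p j.+1) - Z (p j)) - I) < e.

(* dU_t = i U_t dX_t - (1/2) U_t dt,  U_0 = 1; the drift is the integral of
   [U] against the scalar process [t |-> t 1]. *)
Record free_unitary_brownian_motion (X U : R -> A) : Prop := {
  fubm_unitary : forall t, 0 <= t -> unitary_elt (U t) ;
  fubm_adapted : adapted X U ;
  fubm_continuous : L2_continuous U ;
  fubm0 : U 0 = 1 ;
  fubm_sde : forall t, 0 <= t -> exists I D : A,
    [/\ is_integral U X t I, is_integral U (fun r => (r%:C)%:A) t D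
      & U t = 1 + 'i *: I - 2^-1 *: D] }.

End FreeProbability.

Definition catalan (R : realType) (j : nat) : R := 'C(2 * j, j)%:R / j.+1%:R.

Definition scrP_spec (R : realType) (n : nat) (p : {poly R}) : Prop :=
  size p = n.+1 /\
  forall z : R, 0 < z ->
    derive1n n (fun y : R => y ^+ n / (1 + Num.sqrt y)) z
    = p.[Num.sqrt z] / (2 ^+ n * (1 + Num.sqrt z) ^+ n.+1).

(* [scrP_spec] pins down [p] since it fixes its values on all positive reals. *)
Definition scrP (R : realType) (n : nat) : {poly R} :=
  xget 0 [set p : {poly R} | scrP_spec n p].

(* Main.v *)
Require Import Defs.
From HB Require Import structures.
From mathcomp Require Import all_boot all_order all_algebra.
From mathcomp Require Import all_classical all_reals all_analysis.
From mathcomp Require Import complex.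
From mathcomp Require Import ssrAC ring zify.

Set Implicit Arguments.
Unset Strict Implicit.
Unset Printing Implicit Defensive.

Import Order.TTheory GRing.Theory Num.Theory.
Import numFieldNormedType.Exports.

Local Open Scope classical_set_scope.
Local Open Scope ring_scope.
Local Open Scope complex_scope.

(** With [Q = U P U^*] everything takes place in the algebra generated by two
    projections [P], [Q] of trace [1/k].  Put [w = k - 1], [N = 1 - P - Q],
    [D = P - Q]; then [N D = - D N], [N^2 + D^2 = 1], and [N^2] commutes with
    [P], where it restricts to [P Q P].  For [T = kP - 1] and [S = kQ - 1], the
    product [B = T S] has inverse [B' / w^2] with [k^2 N^2 = B + B' + 2w], so
    that [k^(2n) N^(2n)] expands as the Laurent polynomial [(B + w)^(2n) / B^n].
    Anticommutation kills the traces of [D N^(2n)] and makes all odd powers of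
    [N] have the trace of [N], which compares the traces of [B^j] and [B'^j].
    The constant term is the value at [tau (B^j) = 0], which is what freeness
    gives for a Haar unitary; summing it by Pascal's rule gives the Catalan
    form.  The last form follows by induction from
    [(1 - s) P_(n+1) = 2 (n+1) P_n - (2n+1)!! s (1 + s)^(n+1)]. *)

(** * Laurent expansion for a commuting pair with scalar product *)

(** Since [b' b = w^2], the base times [b] is the square [(b + w)^2]. The binomial formula for
    [(b + w)^(2n)], divided by [b^n], then gives the expansion. *)
Lemma expr_palindrome_pair (F : fieldType) (A : algType F) (w : F) (b b' : A) (n : nat) :
  w != 0 -> b * b' = (w ^+ 2)%:A -> b' * b = (w ^+ 2)%:A ->
  (b + b' + (2 * w)%:A) ^+ n = (w ^+ n * 'C(2 * n, n)%:R)%:A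
    + \sum_(1 <= j < n.+1) (w ^+ (n - j) * 'C(2 * n, n - j)%:R) *: (b ^+ j + b' ^+ j).
Proof.
move=> w0 bb' b'b.
have cbb' : GRing.comm b b' by rewrite /GRing.comm bb' b'b.
have cwb : GRing.comm b (w%:A : A) by rewrite /GRing.comm mulr_algr mulr_algl.
set W := b + b' + _.
have WbE : W * b = (b + w%:A) ^+ 2.
  rewrite /W !mulrDl b'b [RHS]expr2 mulrDl !mulrDr !mulr_algl !mulr_algr scalerA.
  rewrite !mul1r scalerDl -!addrA; congr (_ + _).
  by rewrite addrC -!addrA expr2.
have cWb : GRing.comm W b.
  rewrite /W; apply/commr_sym; apply: commrD; first exact: commrD.
  by rewrite /GRing.comm mulr_algr mulr_algl.
have bVn i m : b ^+ i * b' ^+ (i + m) = (w ^+ (2 * i)) *: b' ^+ m.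
  elim: i => [|i IH]; first by rewrite mul1r scale1r.
  rewrite exprSr addSn exprS mulrA -(mulrA _ b b') bb' mulr_algr -scalerAl IH.
  by rewrite scalerA mulnS exprD.
have bVn' i m : b ^+ (i + m) * b' ^+ i = (w ^+ (2 * i)) *: b ^+ m.
  elim: i => [|i IH]; first by rewrite mulr1 scale1r.
  rewrite addSn exprSr exprS mulrA -(mulrA _ b b') bb' mulr_algr -scalerAl IH.
  by rewrite scalerA mulnS exprD.
(* As [b^n b'^n = w^(2n)], scaling by [w^(2n)] and multiplying by [b'^n] replaces the division by
   [b^n]. *)
apply: (@scalerI _ _ (w ^+ (2 * n))); first by rewrite expf_neq0.
have -> : (w ^+ (2 * n)) *: W ^+ n = (b + w%:A) ^+ (2 * n) * b' ^+ n.
  rewrite (exprM (b + _)) -WbE (exprMn_comm _ cWb) -mulrA.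
  by have := bVn n 0; rewrite addn0 expr0 => ->; rewrite -scalerAr mulr1.
rewrite (exprDn_comm _ (commr_sym (commr_sym cwb))).
rewrite mulr_suml.
rewrite -(big_mkord xpredT (fun i => (b ^+ (2 * n - i) * w%:A ^+ i *+ 'C(2 * n, i)) * b' ^+ n)).
have term i : (b ^+ (2 * n - i) * w%:A ^+ i *+ 'C(2 * n, i)) * b' ^+ n
   = (w ^+ i * 'C(2 * n, i)%:R) *: (b ^+ (2 * n - i) * b' ^+ n).
  have -> : (w%:A : A) ^+ i = (w ^+ i)%:A by rewrite exprZn expr1n.
  by rewrite mulr_algr -scaler_nat scalerA -scalerAl mulrC.
under eq_bigr do rewrite term.
have n2 : (n <= (2 * n).+1)%N by rewrite mul2n -addnn -addnS leq_addr.
(* The index [i = n] gives the constant term; smaller indices leave positive powers of [b], larger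
   ones positive powers of [b']. *)
rewrite (big_cat_nat (leq0n n) n2) //= (@big_ltn _ _ _ n); last by rewrite ltnS mul2n -addnn leq_addr.
have -> : (2 * n - n = n)%N by rewrite mul2n -addnn addnK.
have := bVn n 0; rewrite addn0 expr0 => ->.
rewrite addrCA scalerDr !scalerA [in X in _ = X + _](mulrC (w ^+ (2 * n))); congr (_ + _).
rewrite scaler_sumr.
under [RHS]eq_bigr do rewrite !scalerDr.
rewrite big_split /=; congr (_ + _).
  rewrite big_nat_rev /= big_add1 /= !big_nat; apply: eq_bigr => j jn.
  have -> : (2 * n - (0 + n - j.+1) = n + j.+1)%N by lia.
  rewrite add0n bVn' !scalerA; congr (_ *: _).
  have -> : (2 * n = (n - j.+1) + (n + j.+1))%N by lia.
  by rewrite mulrAC [RHS]mulrA -!exprD; congr (w ^+ _ * _); lia.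
rewrite -[n.+1 in LHS]add1n big_addn.
have -> : ((2 * n).+1 - n = n.+1)%N by lia.
rewrite !big_nat; apply: eq_bigr => j jn.
have -> : (2 * n - (j + n) = n - j)%N by lia.
have -> : b ^+ (n - j) * b' ^+ n = w ^+ (2 * (n - j)) *: b' ^+ j.
  by rewrite -bVn subnK //; lia.
rewrite !scalerA; congr (_ *: _).
have -> : 'C(2 * n, j + n) = 'C(2 * n, n - j).
  by rewrite -bin_sub; [congr 'C(_, _)|]; lia.
by rewrite mulrAC [RHS]mulrA -!exprD; congr (w ^+ _ * _); lia.
Qed.

(** * Algebra and traces of two idempotents *)

Section TwoIdempotents.
Variables (F : numFieldType) (A : algType F) (P Q : A).
Hypotheses (PP : P * P = P) (QQ : Q * Q = Q).

(** Coefficient vectors on the words of length at most two in [P] and [Q]. Noncommutative identities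
    become componentwise ones in [F], within reach of [ring]. *)
Definition words2 (c : F * F * F * F * F) : A :=
  let: (c0, c1, c2, c3, c4) := c in
  c0%:A + c1 *: P + c2 *: Q + c3 *: (P * Q) + c4 *: (Q * P).

Definition words1 (c : F * F * F) : A :=
  let: (c0, c1, c2) := c in c0%:A + c1 *: P + c2 *: Q.

Lemma words2D c d : words2 c + words2 d = words2 (c + d).
Proof.
case: c d => [[[[c0 c1] c2] c3] c4] [[[[d0 d1] d2] d3] d4] /=.
by rewrite !scalerDl [LHS](AC (5*5) ((1*6)*(2*7)*(3*8)*(4*9)*(5*10))).
Qed.

Lemma words2Z x c : x *: words2 c =
  words2 (x * c.1.1.1.1, x * c.1.1.1.2, x * c.1.1.2, x * c.1.2, x * c.2).
Proof. by case: c => [[[[c0 c1] c2] c3] c4] /=; rewrite !scalerDr !scalerA. Qed.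

Lemma words1M a b : words1 a * words1 b =
  words2 (a.1.1 * b.1.1, a.1.1 * b.1.2 + a.1.2 * b.1.1 + a.1.2 * b.1.2,
          a.1.1 * b.2 + a.2 * b.1.1 + a.2 * b.2, a.1.2 * b.2, a.2 * b.1.2).
Proof.
case: a b => [[a0 a1] a2] [[b0 b1] b2] /=.
rewrite !mulrDl !mulrDr -!scalerAl -!scalerAr !mul1r !mulr1 PP QQ !scalerA !scalerDl.
by rewrite [LHS](AC (3*3*3) (1*(2*4*5)*(3*7*9)*6*8)).
Qed.

Let N : A := 1 - P - Q.
Let D : A := P - Q.

Let NE : N = words1 (1, - 1, - 1).
Proof. by rewrite /N /= scale1r !scaleN1r. Qed.

Let DE : D = words1 (0, 1, - 1).
Proof. by rewrite /D /= scale0r add0r scale1r !scaleN1r. Qed.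

Lemma idemD_anticomm : D * N = - (N * D).
Proof.
rewrite -[RHS]scaleN1r NE DE !words1M words2Z /=.
by congr (words2 (_, _, _, _, _)); ring.
Qed.

Lemma idemD_square : D * D = 1 - N ^+ 2.
Proof.
have -> : 1 = words2 (1, 0, 0, 0, 0) by rewrite /= !scale0r !addr0 scale1r.
rewrite -[- _]scaleN1r expr2 NE DE !words1M words2Z words2D /=.
by congr (words2 (_, _, _, _, _)); rewrite /=; ring.
Qed.

(** Expanding [N^2 = 1 - P - Q + PQ + QP] gives [P N^2 = PQP = N^2 P]. The exponent is positive
    because the zeroth powers are [1] and [P]. *)
Lemma idem_sandwich n : (P * Q * P) ^+ n.+1 = P * (N ^+ 2) ^+ n.+1.
Proof.
have N2E : N ^+ 2 = 1 - P - Q + (P * Q + Q * P).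
  have -> : 1 - P - Q + (P * Q + Q * P) = words2 (1, -1, -1, 1, 1).
    by rewrite /= !scaleN1r !scale1r addrA.
  by rewrite expr2 NE words1M /=; congr (words2 (_, _, _, _, _)); ring.
have PN : P * N ^+ 2 = P * Q * P.
  by rewrite N2E !(mulrDr, mulrN) !mulrA PP mulr1 subrr sub0r addKr.
have NP : N ^+ 2 * P = P * Q * P.
  rewrite N2E !(mulrDl, mulNr) -!(mulrA _ P P) PP mul1r subrr sub0r addrC -addrA.
  by rewrite subrr addr0.
elim: n => [|n IH]; first by rewrite !expr1 PN.
by rewrite exprS IH mulrA -(mulrA _ P P) PP -PN -mulrA -exprS.
Qed.

Variable w : F.
Let k := w + 1.
Let B := (k *: P - 1) * (k *: Q - 1).
(* [B'] is [w ^+ 2] times the inverse of [B]. *)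
Let B' := (k *: Q - w%:A) * (k *: P - w%:A).

Let BE : B = words2 (1, - k, - k, k ^+ 2, 0).
Proof.
have -> : B = words1 (- 1, k, 0) * words1 (- 1, 0, k).
  by rewrite /B /= !scale0r !addr0 scaleN1r ![- 1 + _]addrC.
by rewrite words1M /=; congr (words2 (_, _, _, _, _)); ring.
Qed.

Let B'E : B' = words2 (w ^+ 2, - (w * k), - (w * k), 0, k ^+ 2).
Proof.
have -> : B' = words1 (- w, 0, k) * words1 (- w, k, 0).
  by rewrite /B' /= !scale0r !addr0 scaleNr ![- _ + _]addrC.
by rewrite words1M /=; congr (words2 (_, _, _, _, _)); ring.
Qed.

Lemma reflections_add : B + B' + (2 * w)%:A = k ^+ 2 *: N ^+ 2.
Proof.
have -> : (2 * w)%:A = words2 (2 * w, 0, 0, 0, 0) by rewrite /= !scale0r !addr0.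
rewrite [N ^+ 2]expr2 NE BE B'E words1M words2Z !words2D /k.
by congr (words2 (_, _, _, _, _)); rewrite /=; ring.
Qed.

Lemma reflections_sub : B - B' = k ^+ 2 *: (N * D) - (k * (w - 1)) *: N.
Proof.
have -> : (k * (w - 1)) *: N
    = words2 (k * (w - 1), - (k * (w - 1)), - (k * (w - 1)), 0, 0).
  rewrite /N /= !scale0r !addr0 !scalerBr !scaleNr //.
rewrite -[- B']scaleN1r -[in X in _ = _ + X]scaleN1r NE DE BE B'E words1M !words2Z !words2D /k.
by congr (words2 (_, _, _, _, _)); rewrite /=; ring.
Qed.

(** On the range and the kernel of [E] the factors act as [w], [1] and as [-1], [-w], with product
    [w] in both cases. *)
Lemma idem_reflection (E : A) : E * E = E ->
  (k *: E - 1) * (k *: E - w%:A) = w%:A /\ (k *: E - w%:A) * (k *: E - 1) = w%:A.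
Proof.
move=> EE; have H x y : x + y = k -> x * y = w ->
    (k *: E - x%:A) * (k *: E - y%:A) = w%:A.
  move=> xy1 xy2; rewrite mulrBl !mulrBr -!scalerAl -!scalerAr mul1r mulr1 EE !scalerA.
  rewrite mulr1 xy2 -!scalerBl opprB addrA addrAC -scalerBl.
  by rewrite [X in X *: E](_ : _ = 0) ?scale0r ?add0r // -xy1; ring.
by split; [move: (H 1 w) | move: (H w 1)]; rewrite scale1r; apply; rewrite /k; ring.
Qed.

Lemma reflections_mul : B * B' = (w ^+ 2)%:A /\ B' * B = (w ^+ 2)%:A.
Proof.
have [P1 P2] := idem_reflection PP; have [Q1 Q2] := idem_reflection QQ.
rewrite /B /B' !mulrA; split.
  by rewrite -(mulrA _ _ (k *: Q - w%:A)) Q1 mulr_algr -scalerAl P1 scalerA expr2.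
by rewrite -(mulrA _ _ (k *: P - 1)) P2 mulr_algr -scalerAl Q2 scalerA expr2.
Qed.

Variable phi : {scalar A}.
Hypotheses (phi1 : phi 1 = 1) (phiC : forall a b, phi (a * b) = phi (b * a)).

Let phiB a b : phi (a - b) = phi a - phi b. Proof. exact: raddfB. Qed.
Let phiZ c a : phi (c *: a) = c * phi a. Proof. exact: linearZ. Qed.

Let comm_D_N2 n : D * (N ^+ 2) ^+ n = (N ^+ 2) ^+ n * D.
Proof.
have cDN : GRing.comm D (N ^+ 2).
  by rewrite /GRing.comm expr2 mulrA idemD_anticomm mulNr -(mulrA N D N) idemD_anticomm mulrN opprK mulrA.
exact: commrX.
Qed.

Let eq_opp_eq0 (x : F) : x = - x -> x = 0.
Proof. by move/eqP; rewrite -addr_eq0 -mulr2n mulrn_eq0 => /eqP. Qed.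

(** Carrying one factor [N] across [D] changes the sign, and cyclicity of the trace brings it back.
    With exponent [0] there would be no [N] to move. *)
Lemma trace_mulDN n : phi (D * (N ^+ 2) ^+ n.+1) = 0.
Proof.
apply: eq_opp_eq0; rewrite -exprM mulnS addSn exprS.
rewrite [in LHS]mulrA idemD_anticomm mulNr raddfN /=; congr (- _).
by rewrite -mulrA phiC -mulrA -exprSr -exprS.
Qed.

Lemma trace_NDN n : phi (N * D * (N ^+ 2) ^+ n) = 0.
Proof.
apply: eq_opp_eq0; rewrite -[in RHS]raddfN -mulNr -idemD_anticomm -!mulrA [LHS]phiC -mulrA.
by congr (phi (_ * _)); rewrite -exprM -exprSr -exprS.
Qed.

(** Replacing one [N^2] by [1 - D^2] lowers the power; the term with [D^2] is its own opposite, by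
    carrying one [D] cyclically across an odd power of [N]. *)
Lemma trace_oddN n : phi (N * (N ^+ 2) ^+ n) = phi N.
Proof.
elim: n => [|n IH]; first by rewrite expr0 mulr1.
have mulN2 (x : A) : x * N ^+ 2 = x - x * (D * D).
  by rewrite idemD_square mulrBr mulr1 opprB addrCA subrr addr0.
rewrite exprSr mulrA mulN2 raddfB /= IH [X in _ - X](_ : _ = 0) ?subr0 //.
apply: eq_opp_eq0; rewrite !mulrA [LHS]phiC !mulrA idemD_anticomm !mulNr raddfN /=.
by rewrite -(mulrA N D) comm_D_N2 !mulrA.
Qed.

(* The induction needs the factor [N ^+ 2 ^+ n]: [B^(j+2) - B'^(j+2)] involves
   [B + B'], hence [N ^+ 2]. *)
Lemma trace_expB_diff j n :
  phi ((B ^+ j - B' ^+ j) * (N ^+ 2) ^+ n) = - (w ^+ (2 * j) - 1) * phi N.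
Proof.
have [BB' B'B] := reflections_mul.
elim/ltn_ind: j n => -[|[|j]] IH n.
- by rewrite !expr0 !subrr mul0r raddf0 oppr0 mul0r.
- rewrite !expr1 reflections_sub mulrBl phiB -!scalerAl !phiZ trace_NDN trace_oddN.
  by rewrite muln1 /k; ring.
(* Three-term recurrence from [B B' = B' B = w^2]. With [B + B' = k^2 N^2 - 2w] the traces obey
   [x_(j+2) = (w^2 + 1) x_(j+1) - w^2 x_j], whose characteristic roots are [1] and [w^2]. *)
have -> : B ^+ j.+2 - B' ^+ j.+2
    = (B ^+ j.+1 - B' ^+ j.+1) * (B + B') - w ^+ 2 *: (B ^+ j - B' ^+ j).
  rewrite mulrBl !mulrDr -!exprSr [B ^+ j.+1]exprSr -mulrA BB' [B' ^+ j.+1]exprSr.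
  rewrite -[in X in _ - (X + _) - _]mulrA B'B !mulr_algr scalerBr.
  by rewrite opprB opprD [RHS](AC (2*2*2) (1*4*(2*6)*(3*5)))/= subrr addNr !addr0.
rewrite -[B + B'](addrK (2 * w)%:A) reflections_add mulrBr mulr_algr -scalerAr.
move: (IH j.+1 (ltnSn _)) (IH j (ltnW (ltnSn _))).
move: (phi N) (B ^+ j.+1 - _) (B ^+ j - _) => z x y IHx IHy.
rewrite !mulrBl -!scalerAl -mulrA -exprS !phiB !phiZ !IHx !IHy.
rewrite !mulnS !exprD /k; ring.
Qed.

Hypothesis w_neq0 : w != 0.
Hypothesis phiPQ : phi P = phi Q.

Lemma trace_sandwich_moment n :
  k ^+ (2 * n.+1) * phi ((P * Q * P) ^+ n.+1)
  = w ^+ n.+1 * 'C(2 * n.+1, n.+1)%:R * phi P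
    - phi N * (\sum_(1 <= j < n.+2) w ^+ (n.+1 - j) * 'C(2 * n.+1, n.+1 - j)%:R)
    + \sum_(1 <= j < n.+2) w ^+ (n.+1 - j) * 'C(2 * n.+1, n.+1 - j)%:R * phi (B ^+ j).
Proof.
have [BB' B'B] := reflections_mul.
have phiN : phi N = 1 - 2 * phi P.
  by rewrite /N !raddfB /= phi1 -phiPQ; ring.
(* Writing [2P = 1 - N + D] reduces the trace of [P N^(2n)] to that of [N^(2n)], as the other two
   terms are known. *)
have PE : 1 - N + D = P + P.
  by rewrite /N /D !opprB [LHS](AC (1*(1*2)*2) ((1*4)*(2*6)*(3*5)))/= !subrr !add0r.
have H2 : 2 * phi (P * (N ^+ 2) ^+ n.+1) = phi ((N ^+ 2) ^+ n.+1) - phi N.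
  rewrite mulr_natl mulr2n -raddfD -mulrDl -PE mulrDl mulrBl mul1r raddfD raddfB /=.
  by rewrite trace_oddN trace_mulDN addr0.
have phiB' j : phi (B' ^+ j) = phi (B ^+ j) + (w ^+ (2 * j) - 1) * phi N.
  have := trace_expB_diff j 0; rewrite expr0 mulr1 raddfB /= mulNr => /eqP.
  by rewrite subr_eq addrC -subr_eq opprK => /eqP ->.
have HW : phi ((k ^+ 2 *: N ^+ 2) ^+ n.+1) = w ^+ n.+1 * 'C(2 * n.+1, n.+1)%:R
    + \sum_(1 <= j < n.+2) w ^+ (n.+1 - j) * 'C(2 * n.+1, n.+1 - j)%:R
        * (2 * phi (B ^+ j) + (w ^+ (2 * j) - 1) * phi N).
  rewrite -reflections_add (expr_palindrome_pair _ w_neq0 BB' B'B) raddfD /= linearZ /= phi1 mulr1.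
  congr (_ + _); rewrite raddf_sum; apply: eq_bigr => j _ /=.
  by rewrite linearZ raddfD /= phiB' addrA -mulr2n mulr_natl.
(* The same expansion for the scalars [b = w^2], [b' = 1], where [w^2 + 1 + 2w = k^2]. It cancels
   the powers [w^(2j)] brought in by [phiB']. *)
have Hk : k ^+ (2 * n.+1) = w ^+ n.+1 * 'C(2 * n.+1, n.+1)%:R
    + \sum_(1 <= j < n.+2) w ^+ (n.+1 - j) * 'C(2 * n.+1, n.+1 - j)%:R * (w ^+ (2 * j) + 1).
  have := @expr_palindrome_pair F F^o w (w ^+ 2) 1 n.+1 w_neq0.
  rewrite mulr1 mul1r => /(_ (esym (mulr1 _)) (esym (mulr1 _))).
  have -> : (w ^+ 2 + 1 + (2 * w) *: (1 : F^o)) = k ^+ 2.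
    by rewrite /k /GRing.scale /=; ring.
  rewrite -exprM => ->; congr (_ + _); first exact: mulr1.
  by apply: eq_bigr => j _; rewrite expr1n exprM.
apply: (@mulfI F 2); first by rewrite pnatr_eq0.
rewrite idem_sandwich mulrCA H2 mulrBr.
rewrite [in X in X - _]exprM -linearZ -exprZn HW Hk.
pose c j : F := w ^+ (n.+1 - j) * 'C(2 * n.+1, n.+1 - j)%:R.
have -> : \sum_(1 <= j < n.+2) c j * (2 * phi (B ^+ j) + (w ^+ (2 * j) - 1) * phi N)
    = 2 * (\sum_(1 <= j < n.+2) c j * phi (B ^+ j))
      + phi N * (\sum_(1 <= j < n.+2) c j * (w ^+ (2 * j) + 1))
      - 2 * phi N * \sum_(1 <= j < n.+2) c j.
  rewrite !mulr_sumr -big_split -sumrB; apply: eq_bigr => j _ /=.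
  by move: (w ^+ (2 * j)) (phi N) => e z; ring.
rewrite phiN /c; ring.
Qed.

End TwoIdempotents.

(** * Central binomials and partial Catalan sums *)

Section CatalanSums.
Variable F : numFieldType.

Lemma central_binom_succ n :
  'C(2 * n.+1, n.+1) = (2 * ('C(2 * n, n) + 'C(2 * n, n.+1)))%N.
Proof.
have -> : (2 * n.+1 = (2 * n).+2)%N by lia.
rewrite binS -[in X in (_ + X)%N](@bin_sub (2 * n).+1 n); last by lia.
have -> : ((2 * n).+1 - n = n.+1)%N by lia.
by rewrite binS addnn -mul2n addnC.
Qed.

Lemma mul_bin_central n : (n.+1 * 'C(2 * n, n.+1) = n * 'C(2 * n, n))%N.
Proof. by rewrite mul_bin_left; congr (_ * _)%N; lia. Qed.

Lemma mul_central_binom n :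
  (n.+1 * 'C(2 * n.+1, n.+1) = 2 * ((2 * n).+1 * 'C(2 * n, n)))%N.
Proof. by have := mul_bin_central n; rewrite central_binom_succ; lia. Qed.

Lemma catalan_binom n :
  'C(2 * n, n)%:R / n.+1%:R = 'C(2 * n, n)%:R - 'C(2 * n, n.+1)%:R :> F.
Proof.
have n1 : n.+1%:R != 0 :> F by rewrite pnatr_eq0.
apply: (mulIf n1); rewrite divfK // mulrBl -!natrM.
have -> : ('C(2 * n, n) * n.+1 = 'C(2 * n, n) + 'C(2 * n, n.+1) * n.+1)%N.
  by have := mul_bin_central n; lia.
by rewrite natrD addrK.
Qed.

(** Truncated expansion of [(1 + w)^m]; only its recurrences in [m] and [r] are used. *)
Let S (w : F) m r := \sum_(0 <= i < r) w ^+ i * 'C(m, i)%:R.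

Let S_pascal w m r : S w m.+1 r.+1 = S w m r.+1 + w * S w m r.
Proof.
rewrite /S !big_nat_recl //= !bin0 -addrA; congr (_ + _).
rewrite mulr_sumr -big_split /=; apply: eq_bigr => i _.
by rewrite binS natrD exprS; ring.
Qed.

Let S_recr w m r : S w m r.+1 = S w m r + w ^+ r * 'C(m, r)%:R.
Proof. by rewrite /S big_nat_recr. Qed.

(** Going from [n] to [n + 1] applies Pascal's rule twice, which multiplies by [(1 + w)^2] up to
    boundary terms. These form the Catalan number, a difference of adjacent binomials. *)
Lemma catalan_partial_sum (w : F) n : w + 1 != 0 ->
  w ^+ n * 'C(2 * n, n)%:R
    - (w - 1) * (\sum_(1 <= j < n.+1) w ^+ (n - j) * 'C(2 * n, n - j)%:R)
  = (w + 1) ^+ (2 * n) * (1 - \sum_(0 <= j < n)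
      w ^+ j.+1 / (w + 1) ^+ (2 * j + 1) * ('C(2 * j, j)%:R / j.+1%:R)).
Proof.
move=> k0; have -> : \sum_(1 <= j < n.+1) w ^+ (n - j) * 'C(2 * n, n - j)%:R
    = S w (2 * n) n.
  rewrite big_add1 /= big_nat_rev /S !big_nat; apply: eq_bigr => j /= jn.
  by have -> : (n - (0 + n - j.+1).+1 = j)%N by lia.
elim: n => [|n IH]; first by rewrite /S !big_nil mulr0 subr0 subr0.
rewrite big_nat_recr //= opprD addrA mulrDr mulnS exprD -mulrA -IH catalan_binom.
rewrite addn1 exprS.
have -> : (2 + 2 * n = (2 * n).+2)%N by [].
have S1 : S w (2 * n).+1 n = S w (2 * n).+1 n.+1 - w ^+ n * 'C((2 * n).+1, n)%:R.
  by rewrite S_recr addrK.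
have S2 : S w (2 * n).+1 n.+1 = (1 + w) * S w (2 * n) n + w ^+ n * 'C(2 * n, n)%:R.
  by rewrite S_pascal S_recr; ring.
have b1 : 'C((2 * n).+1, n)%:R = 'C(2 * n, n)%:R + 'C(2 * n, n.+1)%:R :> F.
  rewrite -(@bin_sub (2 * n).+1 n); last by lia.
  have -> : ((2 * n).+1 - n = n.+1)%N by lia.
  by rewrite binS natrD addrC.
have := central_binom_succ n; rewrite mulnS => ->.
rewrite S_pascal S1 S2 b1 !exprS natrM natrD !invfM.
move: (S w (2 * n) n) ('C(2 * n, n)%:R) ('C(2 * n, n.+1)%:R) => a b e.
by field; rewrite expf_neq0.
Qed.

End CatalanSums.

(* [(2n - 1)!!] *)
Definition odd_fact n := (\prod_(0 <= i < n) (2 * i).+1)%N.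

Lemma odd_factS n : odd_fact n.+1 = (odd_fact n * (2 * n).+1)%N.
Proof. by rewrite /odd_fact big_nat_recr. Qed.

Lemma odd_fact_gt0 n : (0 < odd_fact n)%N.
Proof. by elim: n => [|n IH]; rewrite ?odd_factS ?muln_gt0 ?IH // /odd_fact big_nil. Qed.

Lemma odd_fact_binom n : (odd_fact n * 2 ^ n = 'C(2 * n, n) * n`!)%N.
Proof.
elim: n => [|n IH]; first by rewrite /odd_fact big_nil.
transitivity (2 * (2 * n).+1 * ('C(2 * n, n) * n`!))%N.
  by rewrite -IH odd_factS expnS; ring.
rewrite factS [RHS]mulnA [X in _ = (X * _)%N]mulnC mul_central_binom; ring.
Qed.

(** * The Rodrigues-type polynomials and their recurrence *)

Section RodriguesPolynomials.
Variable R : numFieldType.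

(* If [s^(2n) / (1 + s)] is differentiated [n] times in [z = s^2], passing from
   [n] to [n + 1] amounts to applying [z d/dz + n + 1]. *)
Fixpoint rodP (n : nat) : {poly R} :=
  if n is m.+1 then
    'X * (1 + 'X) * (rodP m)^`() + n%:R * ((2 + 'X) * rodP m)
  else 1.

Let subX_neq0 : 1 - 'X != 0 :> {poly R}.
Proof.
apply/eqP => /(congr1 (fun p : {poly R} => p.[0])) /eqP.
by rewrite !hornerE subr0 oner_eq0.
Qed.

Let rodP_rec_aux n :
  (1 - 'X) * (rodP n)^`() = n.+1%:R * rodP n - (odd_fact n.+1)%:R * (1 + 'X) ^+ n ->
  (1 - 'X) * rodP n.+1
    = 2 * n.+1%:R * rodP n - (odd_fact n.+1)%:R * ('X * (1 + 'X) ^+ n.+1).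
Proof.
move=> H; rewrite /= mulrDr mulrCA H exprS.
by move: (rodP n) ((1 + 'X) ^+ n) (odd_fact n.+1)%:R n.+1%:R => p q c m; ring.
Qed.

(** This differential equation removes the derivative from the definition of [rodP]. At rank [n] it
    yields the recurrence for [rodP n.+1], which is then differentiated to reach rank [n + 1]. *)
Lemma rodP_deriv n : (1 - 'X) * (rodP n)^`()
  = n.+1%:R * rodP n - (odd_fact n.+1)%:R * (1 + 'X) ^+ n.
Proof.
elim: n => [|n IH].
  by rewrite /= /odd_fact big_nat1 -polyC1 derivC mulr0 expr0 !mulr1 subrr.
have rec := rodP_rec_aux IH; have := congr1 deriv rec.
rewrite (odd_factS n.+1) natrM -[(2 * n.+1).+1]addn1 natrD natrM -[n.+2]addn1 natrD.
move: (rodP n.+1) (rodP n) (odd_fact n.+1) rec IH => q p c rec IH.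
rewrite -!polyC_natr -[1 in X in X -> _]polyC1 !(derivM, derivB, derivD, derivX, derivC, deriv_exp).
rewrite polyC1 !polyC_natr => drec.
have {drec} -> : (1 - 'X) * q^`() = q + 2 * n.+1%:R * p^`()
    - c%:R * ((1 + 'X) ^+ n.+1 + 'X * ((1 + 'X) ^+ n *+ n.+1)).
  have -> : (1 - 'X) * q^`() = (0 - 1) * q + (1 - 'X) * q^`() + q by ring.
  rewrite drec; ring.
(* After multiplication by [1 - X], both [(1 - X) q] and [(1 - X) p'] can be replaced, by [rec] and
   [IH]. *)
apply: (mulfI subX_neq0); rewrite -mulr_natr exprS.
move: rec; rewrite exprS; move: ((1 + 'X) ^+ n) IH => y IH rec.
transitivity ((1 - 'X) * q + 2 * n.+1%:R * ((1 - 'X) * p^`())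
  - (1 - 'X) * (c%:R * ((1 + 'X) * y + 'X * (y * n.+1%:R)))); first by ring.
transitivity ((n.+1%:R + 1) * ((1 - 'X) * q)
  - (1 - 'X) * (c%:R * (2 * n.+1%:R + 1) * ((1 + 'X) * y))); last by ring.
by rewrite rec IH; ring.
Qed.

Lemma rodP_rec n : (1 - 'X) * rodP n.+1
  = 2 * n.+1%:R * rodP n - (odd_fact n.+1)%:R * ('X * (1 + 'X) ^+ n.+1).
Proof. exact: rodP_rec_aux (rodP_deriv n). Qed.

Lemma size_rodP n : size (rodP n) = n.+1.
Proof.
(* The leading coefficient [(2n - 1)!!] is carried along with the degree bound, and it is nonzero in
   characteristic zero. *)
suff [s l] : (size (rodP n) <= n.+1)%N /\ (rodP n)`_n = (odd_fact n)%:R.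
  apply/eqP; rewrite eqn_leq s ltnNge; apply/negP => /leq_sizeP /(_ _ (leqnn _)) /eqP.
  by rewrite l pnatr_eq0 gtn_eqF // odd_fact_gt0.
elim: n => [|n [s l]]; first by rewrite size_poly1 coef1 /odd_fact big_nil.
have cE i : (rodP n.+1)`_i.+1 = (rodP n)`_i.+1 *+ (i.+1 + 2 * n.+1) + (rodP n)`_i *+ (i + n.+1).
  have -> : rodP n.+1 = (rodP n)^`() * 'X + (rodP n)^`() * 'X * 'X
      + rodP n *+ (2 * n.+1) + rodP n * 'X *+ n.+1.
    by rewrite /=; ring.
  rewrite !coefD !coefMn !coefMX /= !mulrnDr coef_deriv; case: i => [|i] /=.
    by rewrite addr0 mulr0n add0r.
  by rewrite coef_deriv; ring.
split; last by rewrite cE (leq_sizeP _ _ s) // mul0rn add0r l odd_factS addnS addnn -mul2n natrM mulr_natr.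
apply/leq_sizeP => -[//|i] ni.
by rewrite cE !(leq_sizeP _ _ s) ?mul0rn ?addr0 //; apply: ltnW.
Qed.

(** Induction on [n]: at [s = (k - 2) / k] the recurrence of [rodP] changes the left side by exactly
    one Catalan term. *)
Lemma rodP_catalan (k : R) n : k != 0 -> k - 1 != 0 ->
  2 * (k - 1) ^+ n.+1 / k ^+ (2 * n + 1) *
    ('C(2 * n, n)%:R - (k - 2) / (2 * n`!%:R * (k - 1) ^+ n.+1) * k ^+ n
      * (rodP n).[(k - 2) / k])
  = 1 - \sum_(0 <= j < n)
      (k - 1) ^+ j.+1 / k ^+ (2 * j + 1) * ('C(2 * j, j)%:R / j.+1%:R).
Proof.
move=> k0 w0; elim: n => [|n IH].
  by rewrite big_nil /= !hornerE ?bin0 ?fact0 ?expr1; field; rewrite k0 w0.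
have rec : (1 - (k - 2) / k) * (rodP n.+1).[(k - 2) / k]
    = 2 * n.+1%:R * (rodP n).[(k - 2) / k]
      - (odd_fact n.+1)%:R * ((k - 2) / k * (1 + (k - 2) / k) ^+ n.+1).
  have := congr1 (fun p : {poly R} => p.[(k - 2) / k]) (rodP_rec n).
  rewrite -!polyC_natr -![1 in X in X -> _]polyC1.
  by rewrite !(hornerM, hornerD, hornerN, hornerX, hornerC, horner_exp).
move: (rodP n.+1) rec => q rec.
pose f j : R := (k - 1) ^+ j.+1 / k ^+ (2 * j + 1) * ('C(2 * j, j)%:R / j.+1%:R).
rewrite [RHS](_ : _ = (1 - \sum_(0 <= j < n) f j) - f n); last first.
  by rewrite big_nat_recr //= opprD addrA.
rewrite -IH /f.
have n1 : n.+1%:R != 0 :> R by rewrite pnatr_eq0.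
have f0 : n`!%:R != 0 :> R by rewrite pnatr_eq0 -lt0n fact_gt0.
have k1 : k ^+ n != 0 by rewrite expf_neq0.
have w1 : (k - 1) ^+ n != 0 by rewrite expf_neq0.
have e0 : 2 ^+ n != 0 :> R by rewrite expf_neq0 // pnatr_eq0.
have oE : (odd_fact n)%:R = 'C(2 * n, n)%:R * n`!%:R / 2 ^+ n :> R.
  by apply: (mulIf e0); rewrite divfK // -natrX -!natrM odd_fact_binom.
have bE : 'C(2 * n.+1, n.+1)%:R = 2 * (2 * n.+1%:R - 1) * 'C(2 * n, n)%:R / n.+1%:R :> R.
  apply: (mulIf n1); rewrite divfK // mulrC -(natrM _ n.+1) mul_central_binom !natrM.
  by rewrite -[(2 * n).+1]addn1 natrD natrM -[n.+1]addn1 natrD; ring.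
(* Here [1 - s = 2 / k] and [1 + s = 2 (k - 1) / k], so the recurrence can be solved for the new
   value. *)
have {rec} -> : q.[(k - 2) / k] = k / 2 * (2 * n.+1%:R * (rodP n).[(k - 2) / k]
    - 'C(2 * n, n)%:R * n`!%:R / 2 ^+ n * (2 * n.+1%:R - 1) * ((k - 2) / k * (2 * (k - 1) / k) ^+ n.+1)).
  have w0' : 1 - (k - 2) / k = 2 / k by field; rewrite k0.
  have w1' : 1 + (k - 2) / k = 2 * (k - 1) / k by field; rewrite k0.
  move: rec; rewrite w0' w1' odd_factS natrM oE => rec.
  have -> : q.[(k - 2) / k] = k / 2 * (2 / k * q.[(k - 2) / k]).
    by field; rewrite k0 .
  by rewrite rec exprS; ring.
rewrite bE factS natrM !addn1 mulnS !exprS exprMn exprVn exprMn.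
have -> : k ^+ (2 * n) = k ^+ n * k ^+ n by rewrite mul2n -addnn exprD.
move: (k ^+ n) ((k - 1) ^+ n) (2 ^+ n : R) k1 w1 e0 => x y z x0 y0 z0.
move: (rodP n).[_] ('C(2 * n, n)%:R) (n`!%:R) n.+1%:R f0 n1 => p b c m c0 m0.
by field; rewrite m0 x0 k0 y0 w0 c0 z0.
Qed.

End RodriguesPolynomials.

(** * Iterated derivatives of rational functions of the square root *)

Section SquareRootRational.
Variable R : realType.
Implicit Types (f g : R -> R) (q d : {poly R}) (z : R).

Lemma is_derive_eq_pos f g z df : 0 < z -> (forall y, 0 < y -> f y = g y) ->
  is_derive z 1 f df -> is_derive z 1 g df.
Proof.
move=> z0 fg; apply: near_eq_is_derive; near=> y; apply: fg.
by near: y; exact: lt_nbhsr.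
Unshelve. all: by end_near. Qed.

Lemma is_derive_sqrt_ratio q d z : 0 < z -> d.[Num.sqrt z] != 0 ->
  is_derive z 1 (fun y => q.[Num.sqrt y] / d.[Num.sqrt y])
    ((q^`().[Num.sqrt z] * d.[Num.sqrt z] - q.[Num.sqrt z] * d^`().[Num.sqrt z])
      / (2 * Num.sqrt z * d.[Num.sqrt z] ^+ 2)).
Proof.
move=> z0 dz.
have s0 : Num.sqrt z != 0 by rewrite sqrtr_eq0 -ltNge.
have Ds := is_derive1_sqrt z0.
have Dq : is_derive z 1 (fun y => q.[Num.sqrt y]) (q^`().[Num.sqrt z] * (2 * Num.sqrt z)^-1).
  exact: (@is_derive1_comp _ (horner q)).
have Dd : is_derive z 1 (fun y => d.[Num.sqrt y]) (d^`().[Num.sqrt z] * (2 * Num.sqrt z)^-1).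
  exact: (@is_derive1_comp _ (horner d)).
have := is_deriveM Dq (@is_deriveV _ (fun y => d.[Num.sqrt y]) _ _ _ dz Dd).
move=> H; refine (@is_derive_eq _ _ _ _ _ _ _ _ H _).
by rewrite /GRing.scale /=; field; rewrite s0 dz.
Qed.

(** A class stable under differentiation on the positive half-line; it guarantees that every
    iterated derivative is differentiable there. *)
Definition sqrt_rational f := exists q d, forall z, 0 < z ->
  d.[Num.sqrt z] != 0 /\ f z = q.[Num.sqrt z] / d.[Num.sqrt z].

Lemma sqrt_rational_derive f : sqrt_rational f ->
  (forall z, 0 < z -> derivable f z 1) /\ sqrt_rational (derive1 f).
Proof.
move=> [q [d qd]].
have D z : 0 < z -> is_derive z 1 f ((q^`() * d - q * d^`()).[Num.sqrt z]
      / (2%:P * 'X * d ^+ 2).[Num.sqrt z]).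
  move=> z0; have [dz _] := qd z z0.
  apply: (is_derive_eq_pos z0 (fun y y0 => esym (qd y y0).2)).
  rewrite !(hornerM, hornerD, hornerN, hornerX, hornerC, horner_exp).
  exact: is_derive_sqrt_ratio.
split=> [z z0|]; first by have := D z z0; case.
exists (q^`() * d - q * d^`()), (2%:P * 'X * d ^+ 2) => z z0; split.
  have [dz _] := qd z z0.
  have s0 : Num.sqrt z != 0 by rewrite sqrtr_eq0 -ltNge.
  rewrite !(hornerM, hornerX, hornerC, horner_exp).
  by rewrite mulf_neq0 ?expf_neq0 // mulf_neq0 // pnatr_eq0.
by have Dz := D z z0; rewrite derive1E derive_val.
Qed.

Lemma sqrt_rational_deriven f n : sqrt_rational f -> sqrt_rational (derive1n n f).
Proof. by move=> fr; elim: n => // n IH; rewrite derive1nS; case: (sqrt_rational_derive IH). Qed.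

Lemma sqrt_rational_derivable f n z : sqrt_rational f -> 0 < z ->
  derivable (derive1n n f) z 1.
Proof. by move=> /(sqrt_rational_deriven n) /sqrt_rational_derive [+ _]; exact. Qed.

(** Leibniz's rule with a factor whose second derivative vanishes, so only two terms survive. *)
Lemma derive1n_mulX f n z : sqrt_rational f -> 0 < z ->
  derive1n n.+1 (fun y : R => y * f y) z
    = z * derive1n n.+1 f z + n.+1%:R * derive1n n f z.
Proof.
move=> fr; have Df m (y : R) : 0 < y -> is_derive y 1 (derive1n m f) (derive1n m.+1 f y).
  move=> y0; rewrite derive1nS derive1E; apply: derivableP.
  exact: sqrt_rational_derivable.
(* At [m = 0] the truncated predecessor [m.-1] is harmless, its coefficient being zero. *)
have step m (y : R) : 0 < y -> is_derive y 1
    (fun x : R => x * derive1n m f x + m%:R * derive1n m.-1 f x)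
    (y * derive1n m.+1 f y + m.+1%:R * derive1n m f y).
  move=> y0; have := is_deriveD (is_deriveM (is_derive_id y 1) (Df m y y0))
    (is_deriveZ m%:R (Df m.-1 y y0)).
  move=> H; refine (@is_derive_eq _ _ _ _ _ _ _ _ H _).
  rewrite /GRing.scale /=; case: m {H} => [|m] /=.
    by ring.
  by ring.
elim: n z => [|n IH] z z0.
  rewrite derive1n1 derive1E.
  have D : is_derive z 1 (fun y : R => y * f y) (z * derive1n 1 f z + 1%:R * derive1n 0 f z).
    by apply: (is_derive_eq_pos z0 _ (step 0 z z0)) => y y0; rewrite mul0r addr0.
  by rewrite derive_val.
rewrite derive1nS derive1E; set F := derive1n _ _.
have D : is_derive z 1 F (z * derive1n n.+2 f z + n.+2%:R * derive1n n.+1 f z).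
  by apply: (is_derive_eq_pos z0 _ (step n.+1 z z0)) => y y0; rewrite -IH.
by rewrite derive_val.
Qed.

Let psi n (y : R) := y ^+ n / (1 + Num.sqrt y).

Let psi_rational n : sqrt_rational (psi n).
Proof.
exists ('X ^+ (2 * n)), (1 + 'X) => z z0.
rewrite hornerXn !hornerE exprM sqr_sqrtr ?(ltW z0) //; split=> //.
Qed.

(** Since [psi n.+1] is [y] times [psi n], Leibniz's rule turns the formula at [n] into
    [z d/dz + n + 1] applied to it, which is the recursion defining [rodP]. *)
Lemma derive1n_rodP n z : 0 < z ->
  derive1n n (psi n) z = (rodP R n).[Num.sqrt z] / (2 ^+ n * (1 + Num.sqrt z) ^+ n.+1).
Proof.
elim: n z => [|n IH] z z0.
  by rewrite derive1n0 /psi !expr0 !mul1r expr1 /= -polyC1 hornerC mul1r.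
have -> : psi n.+1 = fun y => y * psi n y.
  by apply/funext => y; rewrite /psi exprS mulrA.
rewrite derive1n_mulX // IH // derive1nS derive1E.
set s := Num.sqrt z; have s0 : s != 0 by rewrite sqrtr_eq0 -ltNge.
have s1 : 1 + s != 0 by rewrite gt_eqF // ltr_pwDl // sqrtr_ge0.
have e2 : 2 ^+ n != 0 :> R by rewrite expf_neq0 // pnatr_eq0.
pose d : {poly R} := (2 ^+ n)%:P * (1%:P + 'X) ^+ n.+1.
have dE (y : R) : d.[y] = 2 ^+ n * (1 + y) ^+ n.+1.
  by rewrite !(hornerM, hornerD, hornerX, hornerC, horner_exp).
have ds : d.[s] != 0 by rewrite dE mulf_neq0 ?expf_neq0.
have D := is_derive_eq_pos z0 (g := derive1n n (psi n)) _ (is_derive_sqrt_ratio (rodP R n) z0 ds).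
have {}D := D (fun y y0 => etrans (congr1 _ (congr1 _ (dE _))) (esym (IH y y0))).
rewrite derive_val /= -/s !dE.
have d'E : d^`().[s] = 2 ^+ n * (n.+1%:R * (1 + s) ^+ n).
  rewrite /d !(derivM, derivD, derivX, derivC, deriv_exp) mul0r !add0r mul1r.
  by rewrite !(hornerM, hornerMn, hornerD, hornerX, hornerC, horner_exp) /= mulr_natl.
rewrite d'E -!polyC_natr -!polyC1 !(hornerM, hornerD, hornerX, hornerC).
rewrite -[z](sqr_sqrtr (ltW z0)) -/s !exprS.
have y0 : (1 + s) ^+ n != 0 by rewrite expf_neq0.
move: ((1 + s) ^+ n) (2 ^+ n : R) y0 e2 => y e y0 e0.
by field; rewrite y0 e0 s0 s1.
Qed.

Lemma scrPE n : scrP R n = rodP R n.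
Proof.
have spec : scrP_spec n (rodP R n) by split; [exact: size_rodP|exact: derive1n_rodP].
rewrite /scrP; case: xgetP => [p _ [_ pP]|/(_ _ spec)//].
(* Evaluating both specifications at the squares [(i + 1)^2] makes the difference vanish at as many
   positive integers as its size, hence identically. *)
apply/eqP; rewrite -subr_eq0; apply/eqP/(@roots_geq_poly_eq0 _ _ [seq i.+1%:R | i <- iota 0 (size (p - rodP R n))]).
- apply/allP => x /mapP [i _ ->]; have x0 : 0 < i.+1%:R :> R by rewrite ltr0n.
  have z0 : 0 < (i.+1%:R : R) ^+ 2 by rewrite exprn_gt0.
  have := pP _ z0; rewrite derive1n_rodP // sqrtr_sqr ger0_norm ?(ltW x0) // => /eqP.
  rewrite rootE hornerD hornerN subr_eq0 eq_sym.
  by rewrite (inj_eq (mulIf _)) // invr_neq0 // mulf_neq0 ?expf_neq0 ?pnatr_eq0.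
- rewrite map_inj_uniq ?iota_uniq // => i j /eqP; rewrite eqr_nat => /eqP [].
  by [].
- by rewrite size_map size_iota.
Qed.

End SquareRootRational.

(** * Rotation by a unitary, and freeness *)

Section FreeRotation.
Variables (R : realType) (A : tracial_vN_algebra R).

(** Takes [Q = v P v^*] for an arbitrary unitary [v], so that it serves both for [U t] and for
    [Uinf]. As [tau P = 1 / k] and [tau N = (k - 2) / k], the constant term is the one summed in
    [catalan_partial_sum]. *)
Lemma trace_rotated_sandwich (P v : A) (k : R[i]) (n : nat) :
  P * P = P -> unitary_elt v -> tau P = k^-1 -> k != 0 -> k - 1 != 0 ->
  k ^+ (2 * n.+1) * (k * tau ((P * v * P * star v * P) ^+ n.+1))
  = k ^+ (2 * n.+1) * (1 - \sum_(0 <= j < n.+1)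
        (k - 1) ^+ j.+1 / k ^+ (2 * j + 1) * ('C(2 * j, j)%:R / j.+1%:R))
    + k * \sum_(1 <= j < n.+2) (k - 1) ^+ (n.+1 - j) * 'C(2 * n.+1, n.+1 - j)%:R
        * tau (((k *: P - 1) * v * (k *: P - 1) * star v) ^+ j).
Proof.
move=> PP [sv vs] tP k0 w0; pose Q := v * P * star v.
have QQ : Q * Q = Q by rewrite /Q -!mulrA (mulrA (star v)) sv mul1r (mulrA P) PP.
have PQ : tau P = tau Q by rewrite /Q [RHS](trace_comm (tauP A)) mulrA sv mul1r.
have TQ : (k *: P - 1) * v * (k *: P - 1) * star v = (k *: P - 1) * (k *: Q - 1).
  rewrite -!mulrA; congr (_ * _); rewrite mulrBl mul1r mulrBr vs -scalerAl -scalerAr.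
  by rewrite !mulrA.
have JQ : P * v * P * star v * P = P * Q * P by rewrite /Q !mulrA.
have := trace_sandwich_moment PP QQ (trace_one (tauP A)) (trace_comm (tauP A)) w0 PQ n.
have := @catalan_partial_sum _ (k - 1) n.+1; rewrite !subrK => /(_ k0) <- E.
have tN : tau (1 - P - Q) = 1 - 2 / k.
  by rewrite !raddfB /= (trace_one (tauP A)) -PQ tP; ring.
rewrite TQ JQ mulrCA E tN tP.
move: (\sum_(1 <= j < n.+2) _) (\sum_(1 <= j < n.+2) _) => x y.
by field; rewrite k0.
Qed.

(** The power is an alternating word in centred elements of two free algebras. *)
Lemma free_alternating_trace0 (P T u : A) (j : nat) :
  free_sets [set P] [set u; star u] ->
  star_algebra_gen [set P] T -> tau T = 0 -> tau u = 0 -> tau (star u) = 0 ->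
  tau ((T * u * T * star u) ^+ j.+1) = 0.
Proof.
move=> fr gT tT tu tsu.
pose L := [:: (true, T); (false, u); (true, T); (false, star u)].
pose s := flatten (nseq j.+1 L).
have gen (S : set A) a : S a -> star_algebra_gen S a by move=> Sa B [_]; exact.
have -> : (T * u * T * star u) ^+ j.+1 = \prod_(x <- s) x.2.
  rewrite /s; elim: j.+1 => [|m IH]; first by rewrite big_nil.
  by rewrite exprS IH /= !big_cons /= !mulrA.
apply: fr => // [x /flattenP[l /nseqP[-> _]]|].
  rewrite !inE => /or4P[] /eqP-> /=; split=> //; apply: gen; [by left|by right].
(* Each block starts on the [true] side and ends on the [false] side, so alternation persists across
   the junctions. *)
have H m x : path (fun x y : bool * A => x.1 != y.1) (false, x) (flatten (nseq m L)).
  by elim: m x => //= m IH x; exact: IH.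
exact: H.
Qed.

End FreeRotation.

Theorem theorem2 (R : realType) (A : tracial_vN_algebra R)
  (X U : R -> A) (Uinf P : A) (k : nat)
  (hX : free_additive_brownian_motion X)
  (hU : free_unitary_brownian_motion X U)
  (hk : (2 <= k)%N)
  (hP : sa_projection P) (hPtau : tau P = k%:R^-1)
  (hPU : free_sets [set P] [set a | exists2 t, 0 <= t & a = U t \/ a = star (U t)])
  (hUinf : haar_unitary Uinf) (hPUinf : free_sets [set P] [set Uinf; star Uinf]) :
  let T : A := k%:R *: P - 1 in
  let J (t : R) : A := P * U t * P * star (U t) * P in
  let Jinf : A := P * Uinf * P * star Uinf * P in
  let m (n : nat) (t : R) : R[i] := k%:R * tau (J t ^+ n) in
  let minf (n : nat) : R[i] := k%:R * tau (Jinf ^+ n) in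
  let kR : R := k%:R in
  forall (n : nat) (t : R), (1 <= n)%N -> 0 < t ->
  [/\ m n t = minf n + k%:R / k%:R ^+ (2 * n) *
        (\sum_(1 <= j < n.+1) (k%:R - 1) ^+ (n - j) * 'C(2 * n, n - j)%:R
           * tau ((T * U t * T * star (U t)) ^+ j)),
      minf n = (1 - \sum_(0 <= j < n)
        (kR - 1) ^+ j.+1 / kR ^+ (2 * j + 1) * catalan R j)%:C
    & minf n = (2 * (kR - 1) ^+ n.+1 / kR ^+ (2 * n + 1)
        * ('C(2 * n, n)%:R
           - (kR - 2) / (2 * n`!%:R * (kR - 1) ^+ n.+1) * kR ^+ n
             * (scrP R n).[(kR - 2) / kR]))%:C].
Proof.
move=> T J Jinf m minf kR n t n1 t0.
have k0 : (k%:R : R[i]) != 0 by rewrite pnatr_eq0 -lt0n ltnW.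
have w0 : (k%:R : R[i]) - 1 != 0.
  by rewrite subr_eq0 pnatr_eq1 gtn_eqF.
have kR0 : kR != 0 by rewrite pnatr_eq0 -lt0n ltnW.
have wR0 : kR - 1 != 0 by rewrite subr_eq0 pnatr_eq1 gtn_eqF.
have PP := hP.2.
have gT : star_algebra_gen [set P] T.
  move=> B [[B1 BD _ _]] /(_ P erefl) BP.
  (* The closure axiom has the form [c a + b], so [-1] is reached as [(-2) 1 + 1]. *)
  have -> : T = k%:R *: P + ((- 2) *: 1 + 1).
    by congr (_ + _); rewrite scaleNr scaler_nat mulr2n opprD addrNK.
  by apply: (BD) => //; apply: BD.
have tT : tau T = 0.
  by rewrite raddfB /= linearZ /= hPtau (trace_one (tauP A)) mulfV // subrr.
have [uinf /(_ 1%N isT) [tu tsu]] := hUinf.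
rewrite !expr1 in tu tsu.
have x0 j : tau ((T * Uinf * T * star Uinf) ^+ j.+1) = 0.
  exact: (free_alternating_trace0 _ hPUinf gT tT tu tsu).
case: n n1 => // n _.
pose M := 1 - \sum_(0 <= j < n.+1)
  ((k%:R : R[i]) - 1) ^+ j.+1 / k%:R ^+ (2 * j + 1) * ('C(2 * j, j)%:R / j.+1%:R).
have K0 : (k%:R : R[i]) ^+ (2 * n.+1) != 0 by rewrite expf_neq0.
(* For [Uinf] every trace in the sum vanishes by [x0], leaving the constant term. *)
have minfE : minf n.+1 = M.
  apply: (mulfI K0); rewrite (trace_rotated_sandwich n PP uinf hPtau k0 w0).
  rewrite [X in _ + k%:R * X]big1_seq ?mulr0 ?addr0 // => -[|j]; rewrite mem_index_iota // => _.
  by rewrite x0 mulr0.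
have MC : M = (1 - \sum_(0 <= j < n.+1)
        (kR - 1) ^+ j.+1 / kR ^+ (2 * j + 1) * catalan R j)%:C.
  rewrite rmorphB rmorph1 rmorph_sum /=; congr (_ - _); apply: eq_bigr => j _.
  by rewrite !(rmorphM, fmorphV, rmorphXn, rmorphB, rmorph1, rmorph_nat).
split; last 2 first.
- by rewrite minfE MC.
- by rewrite minfE MC scrPE rodP_catalan.
rewrite minfE; apply: (mulfI K0).
(* The same identity at [U t] has the same constant term [M]; only the sum of traces remains. *)
rewrite (trace_rotated_sandwich n PP (fubm_unitary hU (ltW t0)) hPtau k0 w0) [RHS]mulrDr.
by congr (_ + _); rewrite mulrA mulrCA mulrV ?mulr1 // unitfE.
Qed.
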